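(* Let $n\ge 1$, $\alpha\in[0,n)$, and let $\phi(x)=\Phi(|x|)$ be a radial function on $\mathbb{R}^n$, where $\Phi:[0,\infty)\to[0,\infty)$ is decreasing, such that $\sup_{r>0}\phi^{\alpha}_r(e_1)<\infty$, where $e_1=(1,0,\dots,0)$. Suppose that there is a constant $C$ with $\|\mathcal{M}^{\alpha}_{\phi}\mu\|_{L^{\frac{n}{n-\alpha},\infty}(\mathbb{R}^n)}\le C\,\mu(\mathbb{R}^n)$ for all finite positive Borel measures $\mu$ on $\mathbb{R}^n$. Then for every finite positive Borel measure $V$ on $\mathbb{R}^n$ and every fixed $\rho>0$, $$\lim_{t\to0^+}\Big\|\mathcal{M}^{\alpha}_{\phi}(V_t)(\cdot)-\sup_{r>0}\phi^{\alpha}_r(\cdot)\,V(\mathbb{R}^n)\Big\|_{L^{\frac{n}{n-\alpha},\infty}(\mathbb{R}^n\setminus B(0,\rho))}=0.$$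
   Context: For $r>0$, $\phi^{\alpha}_r(x)=r^{-(n-\alpha)}\phi(x/r)$. For a positive measure $\mu$, $\mathcal{M}^{\alpha}_{\phi}(\mu)(x)=\sup_{r>0}\frac{1}{r^{n-\alpha}}\int_{\mathbb{R}^n}\phi\big(\frac{x-y}{r}\big)\,d\mu(y)$. For a measure $V$ and $t>0$, the dilation $V_t$ is the measure $V_t(E)=V(E/t)$, where $E/t=\{x/t:x\in E\}$. For a measurable set $E\subset\mathbb{R}^n$ and $0<p<\infty$, $\|f\|_{L^{p,\infty}(E)}=\sup_{\lambda>0}\lambda\,|\{x\in E:|f(x)|>\lambda\}|^{1/p}$, with $|\cdot|$ Lebesgue measure; $B(0,\rho)$ is the open ball of radius $\rho$ centered at $0$. *)

(* Defs.v *)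
(* R^n is modelled as n.-tuple R, which carries the
   library's product (= Borel) sigma-algebra generated by the coordinate maps. *)
From HB Require Import structures.
From mathcomp Require Import all_boot all_order all_algebra.
From mathcomp Require Import all_classical all_reals all_analysis.
Set Implicit Arguments. Unset Strict Implicit. Unset Printing Implicit Defensive.
Import Order.TTheory GRing.Theory Num.Theory.
Local Open Scope ring_scope.
Local Open Scope classical_set_scope.

Section Defs.
Variable R : realType.

Definition rn_tsub {n} (x y : n.-tuple R) : n.-tuple R :=
  [tuple tnth x i - tnth y i | i < n].
Definition rn_tscale {n} (c : R) (x : n.-tuple R) : n.-tuple R :=
  [tuple c * tnth x i | i < n].
Definition rn_enorm {n} (x : n.-tuple R) : R :=
  Num.sqrt (\sum_(i < n) tnth x i ^+ 2).
Definition rn_e1 n : n.-tuple R := [tuple (if val i == 0%N then 1 else 0) | i < n].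
Definition rn_ball0 n (rho : R) : set (n.-tuple R) := [set x | rn_enorm x < rho].

Definition rn_box {n} (a b : n.-tuple R) : set (n.-tuple R) :=
  [set x | forall i, tnth a i <= tnth x i < tnth b i].
Definition rn_box_vol {n} (a b : n.-tuple R) : R :=
  \prod_(i < n) Num.max (tnth b i - tnth a i) 0.
Definition rn_leb_outer n (E : set (n.-tuple R)) : \bar R :=
  ereal_inf [set s | exists a b : nat -> n.-tuple R,
    E `<=` \bigcup_k rn_box (a k) (b k) /\
    s = (\sum_(0 <= k <oo) (rn_box_vol (a k) (b k))%:E)%E].

Definition rn_wnorm n (E : set (n.-tuple R)) (f : n.-tuple R -> \bar R) (p : R)
  : \bar R :=
  ereal_sup [set w | exists2 lam : R, 0 < lam &
    w = (lam%:E * poweR (rn_leb_outer [set x | E x /\ (lam%:E < `|f x|)%E]) p^-1)%E].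

Definition rn_phi {n} (Phi : R -> R) (x : n.-tuple R) : R := Phi (rn_enorm x).
Definition rn_phir {n} (alpha : R) (Phi : R -> R) (r : R) (x : n.-tuple R) : R :=
  r `^ (- (n%:R - alpha)) * rn_phi Phi (rn_tscale r^-1 x).
Definition rn_supphir {n} (alpha : R) (Phi : R -> R) (x : n.-tuple R) : \bar R :=
  ereal_sup [set w | exists2 r : R, 0 < r & w = (rn_phir alpha Phi r x)%:E].

Definition rn_maxfn {n} (alpha : R) (Phi : R -> R)
  (mu : set (n.-tuple R) -> \bar R) (x : n.-tuple R) : \bar R :=
  ereal_sup [set w | exists2 r : R, 0 < r &
    w = ((r `^ (- (n%:R - alpha)))%:E *
         \int[mu]_y (rn_phi Phi (rn_tscale r^-1 (rn_tsub x y)))%:E)%E].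

Definition rn_dil {n} (V : set (n.-tuple R) -> \bar R) (t : R)
  : set (n.-tuple R) -> \bar R :=
  fun E => V [set rn_tscale t^-1 x | x in E].

End Defs.

(* Main.v *)
(* With A = n - alpha, the function sup_r phi_r(x) equals S |x|^(-A), where
   S is its value at e_1, and it lies in weak L^(n/A).  Split V into its restriction
   to a large ball B(0, N) and a remainder of mass at most e.  After dilation the
   first part lives in B(0, tN), so for |x| >= rho and small t the distance from x
   to its support is |x| up to a factor close to 1; as Phi is decreasing, its
   maximal function is S |x|^(-A) V(R^n) up to an error O(e |x|^(-A)).  The
   second part contributes O(e) in weak L^(n/A) by the assumed weak-type bound.
   Here Lebesgue outer measure is only needed to be finitely subadditive and to be
   at most (2 r)^n on a ball of radius r. *)
Require Import Defs.
From HB Require Import structures.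
From mathcomp Require Import all_boot all_order all_algebra.
From mathcomp Require Import all_classical all_reals all_analysis.
From mathcomp Require Import measurable_realfun ring lra.
Import Order.TTheory GRing.Theory Num.Theory.
Local Open Scope ring_scope.
Local Open Scope classical_set_scope.

(** * The Euclidean norm on tuples, measurability, and dilations as pushforwards *)

Section EuclideanNorm.
Context {R : realType} {n : nat}.
Implicit Types x y : n.-tuple R.

Lemma enorm_ge0 x : 0 <= rn_enorm x.
Proof. exact: sqrtr_ge0. Qed.

Lemma enorm_sqr x : rn_enorm x ^+ 2 = \sum_(i < n) tnth x i ^+ 2.
Proof. by rewrite sqr_sqrtr// sumr_ge0// => i _; rewrite sqr_ge0. Qed.

Lemma enorm_tscale c x : rn_enorm (rn_tscale c x) = `|c| * rn_enorm x.
Proof.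
rewrite /rn_enorm -sqrtr_sqr -sqrtrM ?sqr_ge0// mulr_sumr.
by congr Num.sqrt; apply: eq_bigr => i _; rewrite tnth_mktuple exprMn.
Qed.

Lemma ler_enorm_tnth x i : `|tnth x i| <= rn_enorm x.
Proof.
rewrite -sqrtr_sqr ler_wsqrtr// (bigD1 i)//= lerDl.
by rewrite sumr_ge0// => j _; rewrite sqr_ge0.
Qed.

(** With [a = |x|] and [b = |y|], expand the sum of the squares [(b x_i + a y_i)^2], which is
    nonnegative, and divide by [2ab]. If [ab = 0], one of the vectors vanishes. The sign is the one
    that occurs in the expansion of [|x - y|^2]. *)
Lemma cauchy_schwarz x y :
  - \sum_(i < n) tnth x i * tnth y i <= rn_enorm x * rn_enorm y.
Proof.
set a := rn_enorm x; set b := rn_enorm y.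
have a0 : 0 <= a by exact: enorm_ge0.
have b0 : 0 <= b by exact: enorm_ge0.
have tnth0 (z : n.-tuple R) i : rn_enorm z = 0 -> tnth z i = 0.
  by move=> z0; apply/eqP; rewrite -normr_le0 (le_trans (ler_enorm_tnth z i)) ?z0.
have [ab0|ab0] := eqVneq (a * b) 0.
  rewrite ab0 big1 ?oppr0// => i _; apply/eqP; rewrite mulf_eq0.
  move/eqP: ab0; rewrite mulf_eq0 => /orP[] /eqP /tnth0 ->.
    by rewrite eqxx.
  by rewrite eqxx orbT.
have {}a0 : 0 < a by rewrite lt0r a0 andbT; apply: contraNneq ab0 => ->; rewrite mul0r.
have {}b0 : 0 < b by rewrite lt0r b0 andbT; apply: contraNneq ab0 => ->; rewrite mulr0.
rewrite -sumrN.
have : \sum_(i < n) (b * tnth x i + a * tnth y i) ^+ 2 >= 0.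
  by rewrite sumr_ge0// => i _; rewrite sqr_ge0.
have -> : \sum_(i < n) (b * tnth x i + a * tnth y i) ^+ 2 =
   b ^+ 2 * a ^+ 2 + a ^+ 2 * b ^+ 2 -
   (2 * (a * b)) * \sum_(i < n) - (tnth x i * tnth y i).
  have ax : a ^+ 2 = \sum_(i < n) tnth x i ^+ 2 by exact: enorm_sqr.
  have bY : b ^+ 2 = \sum_(i < n) tnth y i ^+ 2 by exact: enorm_sqr.
  rewrite [in LHS](eq_bigr (fun i => b ^+ 2 * tnth x i ^+ 2 +
    a ^+ 2 * tnth y i ^+ 2 - (2 * (a * b)) * - (tnth x i * tnth y i))).
    by rewrite sumrB big_split/= -!mulr_sumr -ax -bY.
  by move=> i _; ring.
move=> h; rewrite -(ler_pM2l (_ : 0 < 2 * (a * b))); last by rewrite !mulr_gt0.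
lra.
Qed.

Lemma ler_enormB x y : rn_enorm (rn_tsub x y) <= rn_enorm x + rn_enorm y.
Proof.
rewrite -(@ler_pXn2r _ 2) ?nnegrE ?addr_ge0 ?enorm_ge0//.
rewrite enorm_sqr.
under eq_bigr do rewrite tnth_mktuple.
have -> : \sum_(i < n) (tnth x i - tnth y i) ^+ 2 =
   rn_enorm x ^+ 2 + rn_enorm y ^+ 2 + 2 * (- \sum_(i < n) tnth x i * tnth y i).
  rewrite !enorm_sqr -sumrN mulr_sumr -!big_split/=.
  by apply: eq_bigr => i _; ring.
by have := cauchy_schwarz x y; nra.
Qed.

Lemma lerB_enorm x y : rn_enorm x - rn_enorm y <= rn_enorm (rn_tsub x y).
Proof.
rewrite lerBlDr.
(* Writing [x = (x - y) - (-y)] lets the triangle inequality for differences apply. *)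
have {1}-> : x = rn_tsub (rn_tsub x y) (rn_tscale (-1) y).
  by apply: eq_from_tnth => i; rewrite !tnth_mktuple; ring.
by rewrite (le_trans (ler_enormB _ _))// enorm_tscale normrN1 mul1r.
Qed.

Lemma enorm_e1 : (1 <= n)%N -> rn_enorm (rn_e1 R n) = 1.
Proof.
move=> n1; rewrite /rn_enorm (bigD1 (Ordinal n1))//= tnth_mktuple/= expr1n.
rewrite big1 ?addr0 ?sqrtr1// => i i0; rewrite tnth_mktuple.
case: ifPn => [/eqP vi0|_]; last by rewrite expr0n.
by move/eqP: i0; case; apply: val_inj.
Qed.

Lemma measurable_enorm : measurable_fun setT (@rn_enorm R n).
Proof.
apply: (@measurableT_comp _ _ _ _ _ _ (@Num.sqrt R)).
  by apply: nondecreasing_measurable => // x y; exact: ler_wsqrtr.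
by apply: measurable_sum => i; apply: measurable_funX; exact: measurable_tnth.
Qed.

Lemma measurable_tscale c : measurable_fun setT (@rn_tscale R n c).
Proof.
apply/measurable_fun_tnthP => i.
have -> : (@tnth n R)^~ i \o rn_tscale c = (fun x => c * tnth x i).
  by apply/funext => x /=; rewrite tnth_mktuple.
by apply: measurable_funM => //; exact: measurable_tnth.
Qed.

Lemma measurable_tsub x : measurable_fun setT (rn_tsub x).
Proof.
apply/measurable_fun_tnthP => i.
have -> : (@tnth n R)^~ i \o rn_tsub x = (fun y => tnth x i - tnth y i).
  by apply/funext => y /=; rewrite tnth_mktuple.
by apply: measurable_funB => //; exact: measurable_tnth.
Qed.

(** The image under [x / t] is the preimage under [t x]. In pushforward form the dilation is a
    measure, and the change of variables formula becomes available. *)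
Lemma rn_dilE (V : set (n.-tuple R) -> \bar R) t : t != 0 ->
  rn_dil V t = pushforward V (rn_tscale t).
Proof.
move=> t0; apply/funext => E; rewrite /rn_dil /pushforward; congr V.
apply/seteqP; split => [_ [x Ex <-]|y Ety] /=.
  suff -> : rn_tscale t (rn_tscale t^-1 x) = x by [].
  by apply: eq_from_tnth => i; rewrite !tnth_mktuple mulrA mulfV ?mul1r.
exists (rn_tscale t y) => //.
by apply: eq_from_tnth => i; rewrite !tnth_mktuple mulrA mulVf ?mul1r.
Qed.

End EuclideanNorm.

(** * Lebesgue outer measure: subadditivity and the measure of balls *)

Section OuterMeasure.
Context {R : realType} {n : nat}.
Implicit Types E F : set (n.-tuple R).
Local Open Scope ereal_scope.

Lemma rn_box_vol_ge0 (a b : n.-tuple R) : (0 <= rn_box_vol a b)%R.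
Proof. by apply: prodr_ge0 => i _; rewrite le_max lexx orbT. Qed.

Lemma rn_leb_outer_ge0 E : 0 <= rn_leb_outer E.
Proof.
apply: le_ereal_inf_tmp => _ [a [b [_ ->]]].
by apply: nneseries_ge0 => k _ _; rewrite lee_fin rn_box_vol_ge0.
Qed.

Lemma le_rn_leb_outer E F : E `<=` F -> rn_leb_outer E <= rn_leb_outer F.
Proof.
move=> EF; apply: ereal_inf_le_tmp => _ [a [b [Fab ->]]].
by exists a, b; split => //; exact: subset_trans Fab.
Qed.

(** The partial sum of length [2k] splits exactly into the two partial sums of length [k], and a
    partial sum of length [N] is at most that of length [2N]. This serves to merge two covers by
    boxes into one. *)
Lemma nneseries_interleave (u v : nat -> \bar R) :
  (forall k, 0 <= u k) -> (forall k, 0 <= v k) ->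
  \sum_(0 <= k <oo) (if odd k then v k./2 else u k./2) <=
  \sum_(0 <= k <oo) u k + \sum_(0 <= k <oo) v k.
Proof.
move=> u0 v0; pose w k := if odd k then v k./2 else u k./2.
rewrite -[leLHS]/(\sum_(0 <= k <oo) w k).
have w0 k : 0 <= w k by rewrite /w; case: ifP.
apply: lime_le; first exact: is_cvg_nneseries.
near=> N.
have wE k : \sum_(0 <= i < k.*2) w i =
    \sum_(0 <= i < k) u i + \sum_(0 <= i < k) v i.
  elim: k => [|k IH]; first by rewrite !big_nil adde0.
  rewrite doubleS !big_nat_recr//= IH /w/= odd_double/= doubleK uphalf_double.
  by rewrite -!addeA; congr (_ + _); rewrite addeCA.
apply: (@le_trans _ _ (\sum_(0 <= i < N.*2) w i)).
  by rewrite lee_sum_nneg_natr// -addnn leq_addr.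
by rewrite wE leeD// nneseries_lim_ge.
Unshelve. all: by end_near. Qed.

Lemma rn_leb_outerU E F : rn_leb_outer (E `|` F) <= rn_leb_outer E + rn_leb_outer F.
Proof.
have [->|Efin] := eqVneq (rn_leb_outer E) +oo.
  by rewrite addye ?leey// gt_eqF// (lt_le_trans _ (rn_leb_outer_ge0 F)).
have [->|Ffin] := eqVneq (rn_leb_outer F) +oo.
  by rewrite addey ?leey// gt_eqF// (lt_le_trans _ (rn_leb_outer_ge0 E)).
apply/lee_addgt0Pr => e e0.
have e20 : (0 < e / 2)%R by rewrite divr_gt0.
have /(lb_ereal_inf_adherent e20)[_ [a [b [Eab ->]]] Elt] : rn_leb_outer E \is a fin_num.
  by rewrite ge0_fin_numE ?rn_leb_outer_ge0// ltey.
have /(lb_ereal_inf_adherent e20)[_ [a' [b' [Fab ->]]] Flt] : rn_leb_outer F \is a fin_num.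
  by rewrite ge0_fin_numE ?rn_leb_outer_ge0// ltey.
(* Both covers are optimal up to [e / 2]; even indices carry the cover of [E], odd ones that of
   [F]. *)
pose c k := if odd k then a' k./2 else a k./2.
pose d k := if odd k then b' k./2 else b k./2.
apply: (@le_trans _ _ (\sum_(0 <= k <oo) (rn_box_vol (c k) (d k))%:E)).
  apply: ereal_inf_lbound; exists c, d; split => //.
  move=> x [/Eab|/Fab] [k _ kx].
    by exists k.*2 => //; rewrite /c /d odd_double doubleK.
  by exists k.*2.+1 => //; rewrite /c /d/= odd_double/= uphalf_double.
have -> : (fun k => \sum_(0 <= i < k) (rn_box_vol (c i) (d i))%:E) =
  (fun k => \sum_(0 <= i < k)
   (if odd i then (rn_box_vol (a' i./2) (b' i./2))%:E else (rn_box_vol (a i./2) (b i./2))%:E)).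
  by apply/funext => k; apply: eq_bigr => i _; rewrite /c /d; case: ifP.
apply: (le_trans (@nneseries_interleave
  (fun k => (rn_box_vol (a k) (b k))%:E) (fun k => (rn_box_vol (a' k) (b' k))%:E) _ _)).
- by move=> k; rewrite lee_fin rn_box_vol_ge0.
- by move=> k; rewrite lee_fin rn_box_vol_ge0.
rewrite [X in X%:E](splitr e) EFinD addeACA.
by apply: leeD; exact: ltW.
Qed.

(** The ball lies in the half-open cube of side [2r], which is box 0 of the cover; all other boxes
    are degenerate. *)
Lemma rn_leb_outer_ball0 (r : R) : (1 <= n)%N -> (0 <= r)%R ->
  rn_leb_outer (@rn_ball0 R n r) <= ((2 * r) ^+ n)%:E.
Proof.
move=> n1 r0.
pose a k : n.-tuple R := [tuple (if k == 0%N then - r else 0)%R | i < n].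
pose b k : n.-tuple R := [tuple (if k == 0%N then r else 0)%R | i < n].
have -> : ((2 * r) ^+ n)%:E = \sum_(0 <= k <oo) (rn_box_vol (a k) (b k))%:E.
  rewrite nneseries_recl//; last by move=> k _; rewrite lee_fin rn_box_vol_ge0.
  rewrite eseries0 => [|k k0 _].
    rewrite adde0 /rn_box_vol; congr EFin.
    under eq_bigr do rewrite !tnth_mktuple/= opprK.
    by rewrite prodr_const card_ord (max_idPl _) ?addr_ge0// mulr_natl mulr2n.
  (* A degenerate box has volume 0 because [n >= 1] provides a zero factor; an empty product would
     be 1. *)
  rewrite /rn_box_vol (bigD1 (Ordinal n1))//= !tnth_mktuple.
  by rewrite gtn_eqF// subrr maxxx mul0r.
apply: ereal_inf_lbound; exists a, b; split => // x xr.
exists 0%N => // i; rewrite !tnth_mktuple/=.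
have := le_lt_trans (ler_enorm_tnth x i) xr.
by rewrite ltr_norml => /andP[/ltW -> ->].
Qed.

End OuterMeasure.

(** * The radial profile of the kernel and pointwise bounds for the maximal function *)

Section MaximalFunction.
Context {R : realType} {n : nat}.
Variables (alpha : R) (Phi : R -> R).
Hypothesis Phi_ge0 : forall s, 0 <= s -> 0 <= Phi s.
Hypothesis Phi_noninc : forall s t, 0 <= s -> s <= t -> Phi t <= Phi s.
Implicit Types x y : n.-tuple R.
Local Notation A := (n%:R - alpha).

(** The radial profile of [rn_supphir]. As a function of a scalar it can be evaluated at bounds for
    [|x - t y|] that are not themselves norms of given points. *)
Definition kernel_sup (s : R) : \bar R :=
  ereal_sup [set w | exists2 r : R, 0 < r & w = (r `^ (- A) * Phi (r^-1 * s))%:E].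

Lemma rn_phirE r x : 0 < r ->
  rn_phir alpha Phi r x = r `^ (- A) * Phi (r^-1 * rn_enorm x).
Proof.
by move=> r0; rewrite /rn_phir /rn_phi enorm_tscale ger0_norm// invr_ge0 ltW.
Qed.

Lemma rn_supphirE x : rn_supphir alpha Phi x = kernel_sup (rn_enorm x).
Proof.
congr ereal_sup; apply/seteqP; split => w [r r0 ->]; exists r => //.
  by rewrite rn_phirE.
by rewrite rn_phirE.
Qed.

Lemma kernel_sup_ge0 s : 0 <= s -> (0 <= kernel_sup s)%E.
Proof.
move=> s0; apply: (@le_trans _ _ (1 `^ (- A) * Phi (1^-1 * s))%:E).
  by rewrite lee_fin mulr_ge0 ?powR_ge0// Phi_ge0// mulr_ge0// invr1.
by apply: ereal_sup_ubound; exists 1.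
Qed.

(** Substituting [r = (s / u) r'] in the supremum pulls out the factor [(s / u)^(-A)]. Used in both
    directions with [u = 1], this gives homogeneity of degree [-A]. *)
Lemma le_kernel_sup s u : 0 < s -> 0 < u ->
  (kernel_sup s <= ((s / u) `^ (- A))%:E * kernel_sup u)%E.
Proof.
move=> s0 u0; apply: ge_ereal_sup => _ [r r0 ->].
have su0 : 0 < s / u by rewrite divr_gt0.
rewrite (_ : r `^ (- A) = (s / u) `^ (- A) * (r / (s / u)) `^ (- A)); last first.
  rewrite -powRM ?ltW// ?divr_gt0//; congr (_ `^ _).
  by field; rewrite !gt_eqF.
rewrite (_ : r^-1 * s = (r / (s / u))^-1 * u); last first.
  by field; rewrite !gt_eqF.
rewrite -mulrA EFinM lee_wpmul2l ?lee_fin ?powR_ge0//.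
by apply: ereal_sup_ubound; exists (r / (s / u)) => //; rewrite divr_gt0.
Qed.

Lemma kernel_supE s : 0 < s -> kernel_sup s = ((s `^ (- A))%:E * kernel_sup 1)%E.
Proof.
move=> s0; apply/le_anti/andP; split.
  by have := @le_kernel_sup s 1 s0 ltr01; rewrite divr1.
have := @le_kernel_sup 1 s ltr01 s0; rewrite div1r => h.
have s0' : (0 <= (s `^ (- A))%:E)%E by rewrite lee_fin powR_ge0.
apply: (le_trans (lee_wpmul2l s0' h)).
rewrite muleA -EFinM -powRM ?invr_ge0 ?(ltW s0)// mulfV ?gt_eqF//.
by rewrite powR1 mul1e.
Qed.

Lemma measurable_rn_phi r x : 0 < r ->
  measurable_fun setT (fun y => (rn_phi Phi (rn_tscale r^-1 (rn_tsub x y)))%:E).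
Proof.
move=> r0; apply/measurable_EFinP.
(* [Phi] is monotone only on the half-line; [Psi] continues it by [Phi 0] to a function monotone on
   all reals, hence measurable. *)
pose Psi s := Phi (Num.max 0 s).
have -> : (fun y => rn_phi Phi (rn_tscale r^-1 (rn_tsub x y))) =
    Psi \o (@rn_enorm R n \o (rn_tscale r^-1 \o rn_tsub x)).
  by apply/funext => y; rewrite /Psi/= max_r ?enorm_ge0.
apply: measurableT_comp.
  apply: nonincreasing_measurable => // s t st.
  by apply: Phi_noninc; [rewrite le_max lexx|exact: le_max2].
apply: measurableT_comp; first exact: measurable_enorm.
by apply: measurableT_comp; [exact: measurable_tscale|exact: measurable_tsub].
Qed.

Lemma rn_phi_ge0 x : 0 <= rn_phi Phi x.
Proof. by rewrite Phi_ge0// enorm_ge0. Qed.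

Local Open Scope ereal_scope.

Lemma integral_pushforward_scale (V : {measure set (n.-tuple R) -> \bar R})
    (t r : R) x : (0 < r)%R ->
  \int[pushforward V (rn_tscale t)]_y (rn_phi Phi (rn_tscale r^-1 (rn_tsub x y)))%:E =
  \int[V]_y (rn_phi Phi (rn_tscale r^-1 (rn_tsub x (rn_tscale t y))))%:E.
Proof.
move=> r0; rewrite ge0_integral_pushforward//.
- exact: measurable_tscale.
- exact: measurable_rn_phi.
- by move=> y _; rewrite lee_fin rn_phi_ge0.
Qed.

Lemma measurable_rn_phi_scale (t r : R) x : (0 < r)%R ->
  measurable_fun setT
    (fun y => (rn_phi Phi (rn_tscale r^-1 (rn_tsub x (rn_tscale t y))))%:E).
Proof.
move=> r0.
exact: (measurableT_comp (measurable_rn_phi r x r0) (measurable_tscale t)).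
Qed.

(** For each [r], the integrand is at least [Phi (u / r)] on [D], since [Phi] is decreasing;
    integrate over [D] alone and take the supremum. The case [V D = 0] is separate because [V D] is
    moved across by division. *)
Lemma kernel_sup_le_rn_maxfn (V : {measure set (n.-tuple R) -> \bar R})
    (t u : R) x D : (0 < t)%R -> measurable D -> V D \is a fin_num ->
  (forall y, D y -> rn_enorm (rn_tsub x (rn_tscale t y)) <= u)%R ->
  kernel_sup u * V D <= rn_maxfn alpha Phi (rn_dil V t) x.
Proof.
move=> t0 mD VD Du.
have [VD0|VD0] := eqVneq (V D) 0.
  rewrite VD0 mule0; apply: le_trans (ereal_sup_ubound _); last by exists 1%R.
  rewrite powR1 mul1e rn_dilE ?gt_eqF// integral_pushforward_scale//.
  by apply: integral_ge0 => y _; rewrite lee_fin rn_phi_ge0.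
have {VD0}VD0 : (0 < fine (V D))%R.
  by rewrite fine_gt0// lt0e VD0 measure_ge0/= -ge0_fin_numE.
rewrite -(fineK VD) -lee_pdivlMr//.
apply: ge_ereal_sup => _ [r r0 ->].
rewrite lee_pdivlMr// fineK// EFinM -muleA.
apply: le_trans (ereal_sup_ubound _); last by exists r.
rewrite rn_dilE ?gt_eqF// lee_wpmul2l ?lee_fin ?powR_ge0//.
rewrite integral_pushforward_scale//.
apply: (@le_trans _ _ (\int[V]_(y in D)
  (rn_phi Phi (rn_tscale r^-1 (rn_tsub x (rn_tscale t y))))%:E)); last first.
  apply: ge0_subset_integral => //; first exact: measurable_rn_phi_scale.
  by move=> y _; rewrite lee_fin rn_phi_ge0.
(* Positive mass gives a point of [D], hence [0 <= u], so that [Phi (u / r)] is nonnegative. *)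
have [/set0P[y0 Dy0]|] := boolP (D != set0); last first.
  by rewrite negbK => /eqP D0; rewrite D0 measure0 ltxx in VD0.
have u0 : (0 <= u)%R by rewrite (le_trans (enorm_ge0 _) (Du _ Dy0)).
rewrite -integral_cst//; apply: ge0_le_integral => //.
- by move=> y _; rewrite lee_fin Phi_ge0// mulr_ge0// invr_ge0 ltW.
- by apply: measurable_funTS; exact: measurable_rn_phi_scale.
- move=> y /Du yu; rewrite lee_fin Phi_noninc// ?enorm_ge0//.
  rewrite enorm_tscale ger0_norm ?invr_ge0 ?(ltW r0)//.
  by rewrite ler_wpM2l// invr_ge0 ltW.
Qed.

(** Split each integral along [D]. On [D] the integrand is at most [Phi (l / r)]; the integral off
    [D] is one against [W], the dilation of [V] restricted to the complement of [D]. *)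
Lemma rn_maxfn_le_kernel_sup (V W : {measure set (n.-tuple R) -> \bar R})
    (t l : R) x D : (0 < t)%R -> measurable D -> (0 <= l)%R ->
  (forall y, D y -> l <= rn_enorm (rn_tsub x (rn_tscale t y)))%R ->
  (forall E, measurable E -> W E = V (rn_tscale t @^-1` E `\` D)) ->
  rn_maxfn alpha Phi (rn_dil V t) x <=
    kernel_sup l * V D + rn_maxfn alpha Phi W x.
Proof.
move=> t0 mD l0 Dl WE.
have mDC : measurable (~` D) by exact: measurableC.
apply: ge_ereal_sup => _ [r r0 ->].
rewrite rn_dilE ?gt_eqF// integral_pushforward_scale//.
rewrite -(setvU D) setUC ge0_integral_setU//; last 3 first.
- by rewrite setUv; exact: measurable_rn_phi_scale.
- by move=> y _; rewrite lee_fin rn_phi_ge0.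
- exact/disj_set2P/setICr.
rewrite ge0_muleDr; last 2 first.
- by apply: integral_ge0 => y _; rewrite lee_fin rn_phi_ge0.
- by apply: integral_ge0 => y _; rewrite lee_fin rn_phi_ge0.
apply: leeD.
  apply: (@le_trans _ _ ((r `^ (- A))%:E * ((Phi (r^-1 * l))%:E * V D))).
    rewrite lee_wpmul2l ?lee_fin ?powR_ge0//.
    rewrite -integral_cst//; apply: ge0_le_integral => //.
    - by move=> y _; rewrite lee_fin rn_phi_ge0.
    - by apply: measurable_funTS; exact: measurable_rn_phi_scale.
    - move=> y /Dl yl; rewrite lee_fin Phi_noninc// ?mulr_ge0 ?invr_ge0 ?(ltW r0)//.
      rewrite enorm_tscale ger0_norm ?invr_ge0 ?(ltW r0)//.
      by rewrite ler_wpM2l// invr_ge0 ltW.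
  by rewrite muleA -EFinM lee_wpmul2r//; apply: ereal_sup_ubound; exists r.
apply: le_trans (ereal_sup_ubound _); last by exists r.
rewrite lee_wpmul2l ?lee_fin ?powR_ge0//.
rewrite (@eq_measure_integral _ _ _ _ (mrestr V mDC)); last first.
  by move=> E mE ED; rewrite /= /mrestr setIidl.
apply: (@le_trans _ _ (\int[mrestr V mDC]_y
    (rn_phi Phi (rn_tscale r^-1 (rn_tsub x (rn_tscale t y))))%:E)).
  apply: ge0_subset_integral => //; first exact: measurable_rn_phi_scale.
  by move=> y _; rewrite lee_fin rn_phi_ge0.
rewrite -integral_pushforward_scale//.
rewrite (@eq_measure_integral _ _ _ _ W)//.
  exact: measurable_tscale.
by move=> mt E mE _; rewrite WE//= /pushforward /mrestr setDE.
Qed.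

End MaximalFunction.

(** * Weak-type estimates and a criterion for convergence to 0 *)

Section WeakNorm.
Context {R : realType} {n : nat}.

Lemma powR_decay_lt (A c m s : R) : 0 < A -> 0 < m -> 0 < s ->
  m < c * s `^ (- A) -> s < (c / m) `^ A^-1.
Proof.
move=> A0 m0 s0 h.
have sA0 : 0 < s `^ A by rewrite powR_gt0.
have cm : s `^ A < c / m.
  rewrite ltr_pdivlMr// mulrC -ltr_pdivlMr//.
  by rewrite powRN in h.
have -> : s = (s `^ A) `^ A^-1 by rewrite -powRrM mulfV ?gt_eqF// powRr1 ?ltW.
by apply: gt0_ltr_powR; rewrite ?invr_gt0 ?nnegrE ?(ltW sA0)// (ltW (lt_trans sA0 cm)).
Qed.

Local Open Scope ereal_scope.

Lemma rn_wnorm_ge0 (E : set (n.-tuple R)) f p : 0 <= rn_wnorm E f p.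
Proof.
apply: le_trans (ereal_sup_ubound _); last by exists 1%R.
by rewrite mul1e poweR_ge0.
Qed.

(** Solve [lam m^(1/p) <= b] for the measure [m] of the superlevel set; [m = +oo] would make the
    left side infinite. *)
Lemma weak_type_bound (E : set (n.-tuple R)) g (p b lam : R) :
  (0 < p)%R -> (0 < lam)%R -> (0 <= b)%R -> rn_wnorm E g p <= b%:E ->
  rn_leb_outer [set x | E x /\ lam%:E < `|g x|] <= ((b / lam) `^ p)%:E.
Proof.
move=> p0 lam0 b0 gb.
have p'0 : (0 < p^-1)%R by rewrite invr_gt0.
have : lam%:E * poweR (rn_leb_outer [set x | E x /\ lam%:E < `|g x|]) p^-1 <= b%:E.
  by apply: le_trans gb; apply: ereal_sup_ubound; exists lam.
case: (rn_leb_outer _) (rn_leb_outer_ge0 [set x | E x /\ lam%:E < `|g x|])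
    => [m| |] //= m0.
- rewrite -EFinM !lee_fin mulrC -ler_pdivlMr// => h.
  rewrite lee_fin in m0.
  have -> : m = ((m `^ p^-1) `^ p)%R by rewrite -powRrM mulVf ?gt_eqF// powRr1.
  by apply: ge0_ler_powR; rewrite ?nnegrE ?powR_ge0 ?divr_ge0 ?(ltW lam0) ?(ltW p0).
- by rewrite gt_eqF// gt0_muley ?lte_fin.
Qed.

(** Where [|f| > lam], the decaying term or [g] exceeds [lam / 2]. The first happens only in a ball,
    of measure at most [2^n (2 eps c / lam)^p], the second on a set of measure at most
    [(2 eps b / lam)^p]. The powers of [lam] cancel, and the bound is linear in [eps]. *)
Lemma rn_wnorm_le_decay (E : set (n.-tuple R)) f g (A c b eps : R) :
  (1 <= n)%N -> (0 < A)%R -> (0 <= c)%R -> (0 <= b)%R -> (0 <= eps)%R ->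
  (forall x, E x -> 0 < rn_enorm x)%R ->
  (forall x, E x -> `|f x| <= (eps * c * rn_enorm x `^ (- A))%:E + g x) ->
  (forall x, 0 <= g x) ->
  rn_wnorm setT g (n%:R / A) <= (eps * b)%:E ->
  rn_wnorm E f (n%:R / A) <=
    (eps * (2 ^+ n * (2 * c) `^ (n%:R / A) + (2 * b) `^ (n%:R / A)) `^ (n%:R / A)^-1)%:E.
Proof.
move=> n1 A0 c0 b0 e0 E0 fg g0 gb.
have n0 : (0 < n%:R :> R)%R by rewrite ltr0n.
set p := (n%:R / A)%R in gb *.
have p0 : (0 < p)%R by rewrite divr_gt0.
have p'0 : (0 < p^-1)%R by rewrite invr_gt0.
set K := (_ + _)%R.
have K0 : (0 <= K)%R by rewrite addr_ge0 ?mulr_ge0 ?powR_ge0// exprn_ge0.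
apply: ge_ereal_sup => _ [lam lam0 ->].
have l20 : (0 < lam / 2)%R by rewrite divr_gt0.
have el0 : (0 <= eps / lam)%R by rewrite divr_ge0// ltW.
set S := [set _ | _].
(* From this radius on, the decaying term is at most [lam / 2]. *)
set r := ((eps * c / (lam / 2)) `^ A^-1)%R.
set G := [set x | [set: n.-tuple R] x /\ (lam / 2)%:E < `|g x|].
have SG : S `<=` @rn_ball0 R n r `|` G.
  move=> x [Ex fx]; have [gx|gx] := ltP (lam / 2)%:E `|g x|; first by right.
  left; apply: powR_decay_lt => //; first exact: E0.
  rewrite -lte_fin; have := lt_le_trans fx (fg _ Ex).
  rewrite gee0_abs// in gx.
  move: (g x) (g0 x) gx => [gx| |]//.
  rewrite !lee_fin !lte_fin => _ h1 h2.
  by move: (_ * _ `^ _)%R h2 => z; lra.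
have SK : rn_leb_outer S <= ((eps / lam) `^ p * K)%:E.
  apply: (le_trans (le_rn_leb_outer _ _ SG)).
  apply: (le_trans (rn_leb_outerU _ _)).
  rewrite mulrDr EFinD; apply: leeD.
    apply: (le_trans (rn_leb_outer_ball0 _ n1 (powR_ge0 _ _))).
    rewrite lee_fin exprMn mulrCA ler_wpM2l ?exprn_ge0//.
    rewrite -powR_mulrn ?powR_ge0// -powRrM (_ : A^-1 * n%:R = p)%R; last by rewrite mulrC.
    rewrite -powRM// ?mulr_ge0//.
    by rewrite le_eqVlt; apply/orP; left; apply/eqP; congr (_ `^ _)%R; field; rewrite gt_eqF.
  apply: (le_trans (weak_type_bound _ _ _ _ _ p0 l20 (mulr_ge0 e0 b0) gb)).
  rewrite lee_fin -powRM// ?mulr_ge0//.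
  by rewrite le_eqVlt; apply/orP; left; apply/eqP; congr (_ `^ _)%R; field; rewrite gt_eqF.
apply: (@le_trans _ _ (lam%:E * poweR ((eps / lam) `^ p * K)%:E p^-1)).
  apply: lee_wpmul2l; first by rewrite lee_fin ltW.
  apply: gt0_ler_poweR => //; first exact: ltW.
    by rewrite in_itv/= rn_leb_outer_ge0 leey.
  by rewrite in_itv/= leey andbT lee_fin mulr_ge0 ?powR_ge0.
rewrite poweR_EFin -EFinM lee_fin powRM ?powR_ge0// -powRrM mulfV ?gt_eqF//.
rewrite powRr1// mulrA; rewrite (_ : lam * (eps / lam) = eps)%R//.
by field; rewrite gt_eqF.
Qed.

(** The bound with [e = 1] makes [f] eventually finite, which reduces the claim to real
    convergence. *)
Lemma cvge0_le (T : Type) (F : set_system T) (FF : Filter F) (f : T -> \bar R) :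
  (forall t, 0 <= f t) ->
  (forall e : R, (0 < e)%R -> \forall t \near F, f t <= e%:E) ->
  f @ F --> 0.
Proof.
move=> f0 fe; apply/fine_cvgP; split.
  near=> t; rewrite ge0_fin_numE//; apply: (@le_lt_trans _ _ 1%:E); last exact: ltry.
  by near: t; exact: fe.
apply/cvgrPdist_le => e e0; near=> t.
have fte : f t <= e%:E by near: t; exact: fe.
have : f t \is a fin_num by rewrite ge0_fin_numE// (le_lt_trans fte)// ltry.
move=> ft; rewrite sub0r normrN/= ger0_norm ?fine_ge0//.
by rewrite -lee_fin fineK.
Unshelve. all: by end_near. Qed.

End WeakNorm.

(** * Concentration of mass in balls and the dilated tail of a measure *)

Section Dilation.
Context {R : realType} {n : nat}.
Local Open Scope ereal_scope.

Lemma lee_abse_subr (M g : \bar R) (s lo up d : R) :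
  lo%:E <= M -> M <= up%:E + g -> 0 <= g -> (up - s <= d)%R -> (s - lo <= d)%R ->
  `|M - s%:E| <= d%:E + g.
Proof.
case: g => [g| |]//; last by move=> *; rewrite addey// leey.
case: M => [M| |]//.
by rewrite -!EFinD !lee_fin ler_norml => *; apply/andP; split; lra.
Qed.

Lemma measurable_rn_ball0 (r : R) : measurable (@rn_ball0 R n r).
Proof.
rewrite (_ : @rn_ball0 R n r = setT `&` @rn_enorm R n @^-1` `]-oo, r[%classic); last first.
  by rewrite setTI; apply/seteqP; split => x; rewrite /rn_ball0/= in_itv.
exact: measurable_enorm.
Qed.

(** Continuity from below along balls of integer radius. *)
Lemma rn_ball0_mass (V : {finite_measure set (n.-tuple R) -> \bar R}) (e : R) :
  (0 < e)%R -> exists2 N : nat, (0 < N)%N & V setT <= V (@rn_ball0 R n N%:R) + e%:E.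
Proof.
move=> e0; pose F (k : nat) := @rn_ball0 R n k%:R.
have FT : \bigcup_k F k = setT.
  apply/seteqP; split => // x _; exists (Num.bound (rn_enorm x)) => //=.
  rewrite /F /rn_ball0/= (le_lt_trans (ler_norm _))//.
  by rewrite ger0_norm ?enorm_ge0// archi_boundP// enorm_ge0.
have : V \o F @ \oo --> V setT.
  rewrite -FT; apply: nondecreasing_cvg_mu.
  - by move=> k; exact: measurable_rn_ball0.
  - by rewrite FT.
  - move=> i j ij; apply/subsetPset => x; rewrite /F /rn_ball0/= => /lt_le_trans; apply.
    by rewrite ler_nat.
rewrite -(fineK (fin_num_measure V _ measurableT)) => /fine_cvgP[_ /cvgrPdist_le].
move=> /(_ e e0) [N _ /(_ N.+1 (leqnSn N))] /= VN.
(* The successor keeps the radius positive, as it later serves as a divisor. *)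
exists N.+1 => //; rewrite -[X in _ <= X + _]fineK; last first.
  by apply: fin_num_measure; exact: measurable_rn_ball0.
rewrite -EFinD lee_fin -lerBlDl; exact: le_trans (ler_norm _) VN.
Qed.

(** The witness is the dilated measure restricted to the complement of [B(0, tN)]. It is a finite
    measure, so the assumed weak-type bound applies to it. *)
Lemma dilated_tail (V : {finite_measure set (n.-tuple R) -> \bar R}) (t N : R) :
  (0 < t)%R ->
  exists W : {finite_measure set (n.-tuple R) -> \bar R},
    forall E, W E = V (rn_tscale t @^-1` E `\` @rn_ball0 R n N).
Proof.
move=> t0.
have mD : measurable (~` @rn_ball0 R n (t * N)) by apply: measurableC; exact: measurable_rn_ball0.
have mt := @measurable_tscale R n t.
have Poo : pushforward V (rn_tscale t) (~` @rn_ball0 R n (t * N)) < +oo.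
  rewrite -ge0_fin_numE ?measure_ge0//; apply: fin_num_measure.
  by rewrite -[X in measurable X]setTI; exact: mt.
pose P : {measure set (n.-tuple R) -> \bar R} := pushforward V (rn_tscale t).
exists (@mfrestr _ _ R _ (P mt) mD Poo) => E.
rewrite /= /mfrestr /mrestr /P /= /pushforward preimage_setI setDE preimage_setC.
do 3 f_equal; apply/seteqP; split => x; rewrite /rn_ball0/= enorm_tscale.
  by rewrite gtr0_norm// ltr_pM2l.
by rewrite gtr0_norm// ltr_pM2l.
Qed.

End Dilation.

(** * Pointwise approximation of the maximal function of a dilated measure *)

Section Convergence.
Context {R : realType} {n : nat}.
Variables (alpha : R) (Phi : R -> R).
Hypothesis Phi_ge0 : forall s, 0 <= s -> 0 <= Phi s.
Hypothesis Phi_noninc : forall s t, 0 <= s -> s <= t -> Phi t <= Phi s.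
Hypothesis alpha_lt : alpha < n%:R.
Variable S : R.
Hypothesis kernel_sup1 : kernel_sup (n := n) alpha Phi 1 = S%:E.
Local Notation A := (n%:R - alpha).

Lemma kernel_sup1_ge0 : 0 <= S.
Proof. by rewrite -lee_fin -kernel_sup1 kernel_sup_ge0. Qed.

Lemma kernel_sup_fin s : 0 < s -> kernel_sup (n := n) alpha Phi s = (S * s `^ (- A))%:E.
Proof. by move=> s0; rewrite kernel_supE// kernel_sup1 -EFinM mulrC. Qed.

Lemma rn_maxfn_ge0 (W : {measure set (n.-tuple R) -> \bar R}) x :
  (0 <= rn_maxfn alpha Phi W x)%E.
Proof.
apply: le_trans (ereal_sup_ubound _); last by exists 1%R.
rewrite powR1 mul1e; apply: integral_ge0 => y _.
by rewrite lee_fin rn_phi_ge0.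
Qed.

(* With q ^ A = 1 + h, a factor q in |x - t y| costs a factor 1 + h in the kernel. *)
Lemma rn_maxfn_dil_approx (V : {finite_measure set (n.-tuple R) -> \bar R})
    (rho e : R) : 0 < rho -> 0 < e ->
  exists2 d : R, 0 < d & forall t, 0 < t -> t < d ->
    exists2 W : {finite_measure set (n.-tuple R) -> \bar R},
      (W setT <= e%:E)%E &
      forall x, rho <= rn_enorm x ->
        (`| rn_maxfn alpha Phi (rn_dil V t) x - rn_supphir alpha Phi x * V setT |
         <= (e * (2 * S) * rn_enorm x `^ (- A))%:E + rn_maxfn alpha Phi W x)%E.
Proof.
move=> rho0 e0; have S0 := kernel_sup1_ge0.
have A0 : 0 < A by rewrite subr_gt0.
have [N N0 VN] := rn_ball0_mass V _ e0.
have mD : measurable (@rn_ball0 R n N%:R) by exact: measurable_rn_ball0.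
have VTE := fineK (fin_num_measure V _ measurableT).
have VDfin := fin_num_measure V _ mD.
have VDE := fineK VDfin.
set v := fine (V setT) in VTE *; set vD := fine (V (@rn_ball0 R n N%:R)) in VDE *.
have vD0 : 0 <= vD by rewrite fine_ge0.
have vDv : vD <= v.
  by rewrite -lee_fin VDE VTE le_measure// inE.
have vve : v <= vD + e by rewrite -lee_fin EFinD VDE VTE.
(* Chosen so that [h v <= e]; adding 1 covers [v = 0]. *)
pose h := e / (v + 1).
have v10 : 0 < v + 1 by lra.
have h0 : 0 < h by rewrite divr_gt0.
have hv : h * v <= e.
  rewrite /h mulrAC ler_pdivrMr// ler_wpM2l//; first exact: ltW.
  by lra.
pose q := (1 + h) `^ A^-1.
have qA : q `^ A = 1 + h.
  by rewrite -powRrM mulVf ?gt_eqF// powRr1//; lra.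
have q1 : 1 < q.
  have -> : 1 = 1 `^ A^-1 :> R by rewrite powR1.
  apply: gt0_ltr_powR; rewrite ?invr_gt0 ?nnegrE//; lra.
have q0 : 0 < q by lra.
have qV1 : q^-1 < 1 by rewrite invf_lt1.
have NR0 : 0 < N%:R :> R by rewrite ltr0n.
(* For [t] below this, [t N <= (1 - 1/q) rho], so [|t y| <= (1 - 1/q) |x|] whenever [|y| < N] and
   [|x| >= rho]. *)
exists ((1 - q^-1) * rho / N%:R).
  by rewrite divr_gt0// mulr_gt0// subr_gt0.
move=> t t0 td.
have [W WE] := dilated_tail V t N%:R t0.
exists W.
  rewrite WE preimage_setT setTD -(@leeD2lE _ (V (@rn_ball0 R n N%:R)))//.
  apply: le_trans VN; rewrite le_eqVlt; apply/orP; left; apply/eqP.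
  rewrite -[in RHS](setvU (@rn_ball0 R n N%:R)) setUC measureU//.
    exact: measurableC.
  exact: setICr.
move=> x rx.
have x0 : 0 < rn_enorm x by exact: lt_le_trans rx.
set s := rn_enorm x in rx x0 *.
have tyx y : @rn_ball0 R n N%:R y -> rn_enorm (rn_tscale t y) <= (1 - q^-1) * s.
  rewrite /rn_ball0/= => yN; rewrite enorm_tscale gtr0_norm//.
  apply: (@le_trans _ _ (t * N%:R)); first by rewrite ler_pM2l// ltW.
  apply: (@le_trans _ _ ((1 - q^-1) * rho)).
    by rewrite -ler_pdivlMr// ltW.
  by rewrite ler_pM2l// subr_gt0.
have lo y : @rn_ball0 R n N%:R y -> q^-1 * s <= rn_enorm (rn_tsub x (rn_tscale t y)).
  by move=> /tyx yN; have := lerB_enorm x (rn_tscale t y); rewrite -/s; lra.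
(* The triangle inequality gives [|x - t y| <= (2 - 1/q) |x|]; hence the same [q] serves for the
   upper and the lower bound. *)
have qq : 2 - q^-1 <= q.
  rewrite -subr_ge0 (_ : _ - _ = (q - 1) ^+ 2 / q); last by field; rewrite gt_eqF.
  by rewrite divr_ge0 ?sqr_ge0 ?ltW.
have up y : @rn_ball0 R n N%:R y -> rn_enorm (rn_tsub x (rn_tscale t y)) <= q * s.
  move=> /tyx yN; have := ler_enormB x (rn_tscale t y); rewrite -/s.
  by move: (rn_enorm _) yN (rn_enorm _) => z yN z'; nra.
have qVA : (q^-1 * s) `^ (- A) = (1 + h) * s `^ (- A).
  rewrite powRM ?invr_ge0 ?(ltW q0) ?(ltW x0)//; congr (_ * _).
  have qV : q^-1 = q `^ (-1) by rewrite powR_inv1// ltW.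
  by rewrite qV -powRrM mulrNN mul1r qA.
have qNA : (q * s) `^ (- A) = (1 + h)^-1 * s `^ (- A).
  by rewrite powRM ?(ltW q0) ?(ltW x0)// powRN qA.
have hV : 1 - h <= (1 + h)^-1.
  rewrite -[leRHS]mul1r ler_pdivlMr; last lra.
  by have := sqr_ge0 h; rewrite expr2; lra.
have sA0 : 0 <= s `^ (- A) by exact: powR_ge0.
have Sa0 : 0 <= S * s `^ (- A) by exact: mulr_ge0.
rewrite rn_supphirE kernel_sup_fin// -VTE -EFinM -/s.
apply: (@lee_abse_subr _ _ _ _ (S * (q * s) `^ (- A) * vD)
  (S * (q^-1 * s) `^ (- A) * vD)).
- rewrite EFinM VDE -kernel_sup_fin ?mulr_gt0//.
  exact: kernel_sup_le_rn_maxfn.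
- rewrite EFinM VDE -kernel_sup_fin ?mulr_gt0 ?invr_gt0//.
  apply: rn_maxfn_le_kernel_sup => //.
    by rewrite mulr_ge0 ?invr_ge0 ?(ltW q0) ?(ltW x0).
  by move=> E _; exact: WE.
- exact: rn_maxfn_ge0.
- rewrite qVA -subr_ge0 (_ : _ - _ =
      S * s `^ (- A) * (2 * e - ((1 + h) * vD - v))); last by ring.
  apply: mulr_ge0 => //.
  have : h * vD <= h * v by rewrite ler_pM2l.
  lra.
(* The lower bound loses [e] twice: [v - vD <= e] for the mass outside the ball and [h vD <= e] for
   the distortion of distances. This is the origin of the factor 2 in [2 * S]. *)
- rewrite qNA -subr_ge0 (_ : _ - _ =
      S * s `^ (- A) * (2 * e - (v - (1 + h)^-1 * vD))); last by ring.
  apply: mulr_ge0 => //.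
  have : h * vD <= h * v by rewrite ler_pM2l.
  have : (1 - h) * vD <= (1 + h)^-1 * vD by rewrite ler_wpM2r.
  lra.
Qed.

End Convergence.

(** * Passage to the limit in the weak norm *)

Theorem theorem1p1 (R : realType) (n : nat) (alpha : R) (Phi : R -> R) :
  (1 <= n)%N ->
  0 <= alpha < n%:R ->
  (forall s : R, 0 <= s -> 0 <= Phi s) ->
  (forall s t : R, 0 <= s -> s <= t -> Phi t <= Phi s) ->
  (ereal_sup [set w | exists2 r : R, (0 < r)%R & w = (rn_phir alpha Phi r (rn_e1 R n))%:E]
     < +oo)%E ->
  (exists C : R, forall mu : {finite_measure set (n.-tuple R) -> \bar R},
     (rn_wnorm setT (rn_maxfn alpha Phi mu) (n%:R / (n%:R - alpha))%R
       <= C%:E * mu setT)%E) ->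
  forall (V : {finite_measure set (n.-tuple R) -> \bar R}) (rho : R),
    0 < rho ->
    (fun t : R =>
       rn_wnorm (~` @rn_ball0 R n rho)
         (fun x => (rn_maxfn alpha Phi (rn_dil V t) x - rn_supphir alpha Phi x * V setT)%E)
         (n%:R / (n%:R - alpha))%R)
      @ 0^'+ --> 0%E.
Proof.
move=> n1 /andP[_ alpha_lt] Phi_ge0 Phi_noninc e1_fin [C hC] V rho rho0.
set Ks := ereal_sup _ in e1_fin.
have KsE : Ks = kernel_sup (n := n) alpha Phi 1.
  by rewrite -(enorm_e1 n1) -rn_supphirE.
have Ks_fin : kernel_sup (n := n) alpha Phi 1 \is a fin_num.
  by rewrite ge0_fin_numE -?KsE// KsE kernel_sup_ge0.
set S := fine (kernel_sup (n := n) alpha Phi 1).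
have SE : kernel_sup (n := n) alpha Phi 1 = S%:E by rewrite fineK.
have S0 : 0 <= S := kernel_sup1_ge0 _ _ Phi_ge0 _ SE.
have A0 : 0 < n%:R - alpha by rewrite subr_gt0.
(* The given [C] may be negative, while [rn_wnorm_le_decay] takes a nonnegative constant. *)
pose b := Num.max C 0.
pose p := n%:R / (n%:R - alpha).
pose K := (2 ^+ n * (2 * (2 * S)) `^ p + (2 * b) `^ p) `^ p^-1.
have K0 : 0 <= K by exact: powR_ge0.
apply: cvge0_le => [t|e' e'0]; first exact: rn_wnorm_ge0.
(* [K] is the factor from [rn_wnorm_le_decay] with [c = 2 S], so the final bound [e K] is at most
   [e']; adding 1 covers [K = 0]. *)
pose e := e' / (K + 1).
have e0 : 0 < e by rewrite divr_gt0//; lra.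
have eK : e * K <= e'.
  by rewrite /e mulrAC ler_pdivrMr ?ler_wpM2l//; lra.
have [d d0 hd] :=
  rn_maxfn_dil_approx _ _ Phi_ge0 Phi_noninc alpha_lt _ SE V _ _ rho0 e0.
near=> t.
have t0 : 0 < t by near: t; exact: nbhs_right_gt.
have td : t < d by near: t; exact: nbhs_right_lt.
have [W We hW] := hd _ t0 td.
apply: (@le_trans _ _ (e * K)%:E); last by rewrite lee_fin.
have xrho x : (~` @rn_ball0 R n rho) x -> rho <= rn_enorm x.
  by move=> /negP; rewrite -leNgt.
apply: (@rn_wnorm_le_decay _ _ _ _ (rn_maxfn alpha Phi W) _ _ b) => //.
- by rewrite mulr_ge0.
- by rewrite le_max lexx orbT.
- exact: ltW.
- by move=> x /xrho; exact: lt_le_trans.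
- by move=> x /xrho; exact: hW.
- by move=> x; exact: rn_maxfn_ge0.
(* The weak-type hypothesis is applied to the tail [W] alone, whose mass is at most [e]. *)
apply: (le_trans (hC W)); rewrite EFinM muleC.
apply: (@le_trans _ _ (W setT * b%:E)%E).
  by rewrite lee_wpmul2l// lee_fin le_max lexx.
by rewrite lee_wpmul2r// lee_fin le_max lexx orbT.
Unshelve. all: by end_near. Qed.
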